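(* Let $k$ be any field, let $Q$ and $Q'$ be finite quivers, and let $\theta=(\theta_a)_{a\in Q_0}$ and $\theta'=(\theta'_{a'})_{a'\in Q'_0}$ be rational weights of $Q$ and $Q'$ respectively. Let $\overline{\theta}=(\theta_a+\theta'_{a'})_{(a,a')\in Q_0\times Q'_0}$, a weight of the internal product $Q\otimes Q'$. Suppose that the representation $(V,\rho)$ of $Q$ over $k$ is $\theta$-semistable and the representation $(W,\sigma)$ of $Q'$ over $k$ is $\theta'$-semistable. Then the representation $(V,\rho)\otimes(W,\sigma)$ of $Q\otimes Q'$ is $\overline{\theta}$-semistable.
   Context: A quiver $Q=(Q_0,Q_1,\mathrm{s},\mathrm{t})$ consists of finite sets $Q_0\neq\emptyset$ (vertices), $Q_1$ (arrows) and maps $\mathrm{s},\mathrm{t}:Q_1\to Q_0$ (source, target). A representation $(V,\rho)$ of $Q$ over $k$ is a family $V=(V_a)_{a\in Q_0}$ of finite-dimensional $k$-vector spaces with $k$-linear maps $\rho_\alpha:V_{\mathrm{s}(\alpha)}\to V_{\mathrm{t}(\alpha)}$, $\alpha\in Q_1$. A weight of $Q$ is an element $\theta\in\mathbf{R}^{Q_0}$; it is rational if all $\theta_a\in\mathbf{Q}$. For a non-zero representation, $\mathrm{rk}(V,\rho)=\sum_{a}\dim_k V_a$, $\deg_\theta(V,\rho)=\sum_a\theta_a\dim_k V_a$, $\mu_\theta(V,\rho)=\deg_\theta(V,\rho)/\mathrm{rk}(V,\rho)$. A non-zero representation is $\theta$-semistable if $\mu_\theta(W,\sigma)\le\mu_\theta(V,\rho)$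 for every non-zero proper subrepresentation $(W,\sigma)$. The internal product $Q\otimes Q'$ of quivers $Q,Q'$ has vertex set $Q_0\times Q'_0$ and arrow set $(Q_0\times Q'_1)\sqcup(Q_1\times Q'_0)$; an arrow $(a,\alpha')\in Q_0\times Q_1'$ goes from $(a,\mathrm{s}(\alpha'))$ to $(a,\mathrm{t}(\alpha'))$, and an arrow $(\alpha,a')\in Q_1\times Q_0'$ goes from $(\mathrm{s}(\alpha),a')$ to $(\mathrm{t}(\alpha),a')$. The tensor product of a representation $(V,\rho)$ of $Q$ and a representation $(W,\sigma)$ of $Q'$ is the representation $(V,\rho)\otimes(W,\sigma)=((V_a\otimes W_{a'})_{(a,a')},(\tau_\gamma)_\gamma)$ of $Q\otimes Q'$ with $\tau_{(a,\alpha')}=\mathbf{1}_{V_a}\otimes\sigma_{\alpha'}$ and $\tau_{(\alpha,a')}=\rho_\alpha\otimes\mathbf{1}_{W_{a'}}$. *)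

(* Defs.v *)
From HB Require Import structures.
From mathcomp Require Import all_boot all_order all_algebra.
From mathcomp Require Import classical_sets reals.

Set Implicit Arguments.
Unset Strict Implicit.
Unset Printing Implicit Defensive.

Import Order.TTheory GRing.Theory Num.Theory.
Local Open Scope ring_scope.

(** ** Tensor product of finite-dimensional vector spaces

    MathComp has no tensor product of [vectType]s.  We take the canonical model
    V (x) W = Hom(V^*, W), in which v (x) w is the map phi |-> phi(v) w; this is
    valid because V is finite-dimensional, and [tens_universal] below shows
    that it has the universal property of the tensor product. *)
Section Tensor.
Variable k : fieldType.
Implicit Types V W X : vectType k.

Definition dual V : vectType k := 'Hom(V, k^o).

Definition tensor V W : vectType k := 'Hom(dual V, W).

Definition tens_fun V W (v : V) (w : W) (phi : dual V) : W := (phi v : k) *: w.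

Fact tens_fun_is_linear V W (v : V) (w : W) : linear (tens_fun v w).
Proof.
by move=> a x y; rewrite /tens_fun add_lfunE scale_lfunE scalerDl -scalerA.
Qed.
HB.instance Definition _ V W (v : V) (w : W) :=
  GRing.isLinear.Build k (dual V) W _ (tens_fun v w) (tens_fun_is_linear v w).

Definition tens V W (v : V) (w : W) : tensor V W := linfun (tens_fun v w).

Lemma tensE V W (v : V) (w : W) (phi : dual V) :
  tens v w phi = (phi v : k) *: w.
Proof. by rewrite lfunE. Qed.

Lemma tens_linearl V W (w : W) : linear (fun v : V => tens v w).
Proof.
move=> a x y; apply/lfunP => phi.
by rewrite add_lfunE scale_lfunE !tensE linearP scalerDl -scalerA.
Qed.

Lemma tens_linearr V W (v : V) : linear (fun w : W => tens v w).
Proof.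
move=> a x y; apply/lfunP => phi.
by rewrite add_lfunE scale_lfunE !tensE scalerDr !scalerA mulrC.
Qed.

Lemma tens_universal V W X (b : 'Hom(V, 'Hom(W, X))) :
  exists! L : 'Hom(tensor V W, X), forall v w, L (tens v w) = b v w.
Proof.
pose e := vbasis {:V}; pose n := \dim {:V}.
pose d i : dual V := linfun (coord e i : V -> k^o).
have eE (v : V) : v = \sum_(i < n) (d i v : k) *: e`_i.
  rewrite {1}(coord_vbasis (memvf v)).
  by apply: eq_bigr => i _; rewrite lfunE.
pose Lf (T : tensor V W) : X := \sum_(i < n) b e`_i (T (d i)).
have Lf_lin : linear Lf.
  move=> a x y; rewrite /Lf scaler_sumr -big_split; apply: eq_bigr => i _ /=.
  by rewrite add_lfunE scale_lfunE linearP.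
pose LfM := GRing.isLinear.Build k (tensor V W) X _ Lf Lf_lin.
pose LfL : {linear tensor V W -> X} := HB.pack Lf LfM.
exists (linfun LfL); split=> [v w|L LE].
  rewrite lfunE /= /Lf [in RHS](eE v) linear_sum sum_lfunE.
  by apply: eq_bigr => i _; rewrite tensE !linearZ scale_lfunE.
apply/lfunP => T; rewrite lfunE /= /Lf.
under eq_bigr => i _ do rewrite -LE.
rewrite -linear_sum; congr (L _); apply/lfunP => phi; rewrite sum_lfunE.
under eq_bigr => i _ do rewrite tensE -linearZ.
rewrite -linear_sum; congr (T _); apply/lfunP => v.
rewrite sum_lfunE [in RHS](eE v) linear_sum.
by apply: eq_bigr => i _; rewrite scale_lfunE linearZ; apply: mulrC.
Qed.

Lemma dim_tensor V W : \dim {:tensor V W} = (\dim {:V} * \dim {:W})%N.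
Proof.
rewrite !dimvf; change (dim V * 1 * dim W = dim V * dim W)%N.
by rewrite muln1.
Qed.

Variables (V V' W W' : vectType k).

Definition dual_hom_fun (f : 'Hom(V, V')) (phi : dual V') : dual V :=
  (phi \o f)%VF.

Fact dual_hom_fun_is_linear f : linear (dual_hom_fun f).
Proof. by move=> a x y; rewrite /dual_hom_fun comp_lfunDl -comp_lfunZl. Qed.
HB.instance Definition _ f :=
  GRing.isLinear.Build k (dual V') (dual V) _ (dual_hom_fun f)
    (dual_hom_fun_is_linear f).

Definition dual_hom f : 'Hom(dual V', dual V) := linfun (dual_hom_fun f).

Lemma dual_homE f phi : dual_hom f phi = (phi \o f)%VF.
Proof. by rewrite lfunE. Qed.

Definition tens_hom_fun (f : 'Hom(V, V')) (g : 'Hom(W, W')) (T : tensor V W) :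
  tensor V' W' := (g \o (T \o dual_hom f))%VF.

Fact tens_hom_fun_is_linear f g : linear (tens_hom_fun f g).
Proof.
move=> a x y; rewrite /tens_hom_fun comp_lfunDl comp_lfunDr.
by rewrite -comp_lfunZl -comp_lfunZr.
Qed.
HB.instance Definition _ f g :=
  GRing.isLinear.Build k (tensor V W) (tensor V' W') _ (tens_hom_fun f g)
    (tens_hom_fun_is_linear f g).

Definition tens_hom f g : 'Hom(tensor V W, tensor V' W') :=
  linfun (tens_hom_fun f g).

Lemma tens_homE f g v w : tens_hom f g (tens v w) = tens (f v) (g w).
Proof.
apply/lfunP => phi; rewrite lfunE /= /tens_hom_fun !comp_lfunE dual_homE.
by rewrite !tensE comp_lfunE linearZ.
Qed.

End Tensor.

(** ** Quivers and representations *)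

Record quiver := Quiver {
  vertex : finType;
  arrow : finType;
  source : arrow -> vertex;
  target : arrow -> vertex;
  vertex_gt0 : (0 < #|vertex|)%N
}.

Record representation (k : fieldType) (Q : quiver) := Representation {
  rep_space : vertex Q -> vectType k;
  rep_map : forall alpha : arrow Q,
    'Hom(rep_space (source alpha), rep_space (target alpha))
}.

Definition nonzero_rep (k : fieldType) (Q : quiver) (V : representation k Q) :=
  exists a : vertex Q, {: rep_space V a}%VS != 0%VS.

Record subrep (k : fieldType) (Q : quiver) (V : representation k Q) := Subrep {
  subrep_space : forall a : vertex Q, {vspace rep_space V a};
  subrep_stable : forall alpha : arrow Q,
    (rep_map V alpha @: subrep_space (source alpha)
       <= subrep_space (target alpha))%VS
}.

Definition proper_subrep (k : fieldType) (Q : quiver) (V : representation k Q)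
    (U : subrep V) :=
  exists a : vertex Q, subrep_space U a != {: rep_space V a}%VS.

Section RepOfSubrep.
Variables (k : fieldType) (Q : quiver) (V : representation k Q) (U : subrep V).

Definition subrep_map (alpha : arrow Q) :
    'Hom(subvs_of (subrep_space U (source alpha)),
         subvs_of (subrep_space U (target alpha))) :=
  linfun (vsproj (subrep_space U (target alpha)) \o rep_map V alpha \o vsval).

Lemma subrep_mapE alpha x :
  vsval (subrep_map alpha x) = rep_map V alpha (vsval x).
Proof.
rewrite lfunE /= vsprojK //; apply: (subvP (subrep_stable U alpha)).
exact: memv_img (subvsP x).
Qed.

Definition rep_of_subrep : representation k Q :=
  @Representation k Q (fun a => subvs_of (subrep_space U a)) subrep_map.

End RepOfSubrep.

(** ** Weights, slope and semistability *)

Definition weight (R : realType) (Q : quiver) := {ffun vertex Q -> R}.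

Definition rational_weight (R : realType) (Q : quiver) (theta : weight R Q) :=
  forall a, rational (theta a).

Section Semistable.
Variables (R : realType) (k : fieldType) (Q : quiver) (theta : weight R Q).
Implicit Type V : representation k Q.

Definition rep_rk V : nat := \sum_(a : vertex Q) \dim {: rep_space V a}.

Definition rep_deg V : R :=
  \sum_(a : vertex Q) theta a * (\dim {: rep_space V a})%:R.

Definition rep_slope V : R := rep_deg V / (rep_rk V)%:R.

Definition semistable V : Prop :=
  nonzero_rep V /\
  forall U : subrep V, nonzero_rep (rep_of_subrep U) -> proper_subrep U ->
    rep_slope (rep_of_subrep U) <= rep_slope V.

End Semistable.

(** ** Internal product of quivers and tensor product of representations *)

Section InternalProduct.
Variables Q Q' : quiver.

Definition prod_vertex : finType := (vertex Q * vertex Q')%type.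

Definition prod_arrow : finType :=
  ((vertex Q * arrow Q') + (arrow Q * vertex Q'))%type.

Definition prod_source (g : prod_arrow) : prod_vertex :=
  match g with
  | inl p => (p.1, source p.2)
  | inr p => (source p.1, p.2)
  end.

Definition prod_target (g : prod_arrow) : prod_vertex :=
  match g with
  | inl p => (p.1, target p.2)
  | inr p => (target p.1, p.2)
  end.

Fact prod_vertex_gt0 : (0 < #|prod_vertex|)%N.
Proof. by rewrite card_prod muln_gt0 !vertex_gt0. Qed.

Definition internal_product : quiver :=
  @Quiver prod_vertex prod_arrow prod_source prod_target prod_vertex_gt0.

End InternalProduct.

Section TensorRep.
Variables (k : fieldType) (Q Q' : quiver).
Variables (V : representation k Q) (W : representation k Q').

Definition tensor_space (p : vertex (internal_product Q Q')) : vectType k :=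
  tensor (rep_space V p.1) (rep_space W p.2).

Definition tensor_map (g : arrow (internal_product Q Q')) :
    'Hom(tensor_space (source g), tensor_space (target g)) :=
  match g with
  | inl p => tens_hom (\1%VF : 'End(rep_space V p.1)) (rep_map W p.2)
  | inr p => tens_hom (rep_map V p.1) (\1%VF : 'End(rep_space W p.2))
  end.

Definition tensor_rep : representation k (internal_product Q Q') :=
  @Representation k (internal_product Q Q') tensor_space tensor_map.

End TensorRep.

Definition sum_weight (R : realType) (Q Q' : quiver)
    (theta : weight R Q) (theta' : weight R Q') :
    weight R (internal_product Q Q') :=
  [ffun p : vertex Q * vertex Q' => theta p.1 + theta' p.2].

(* Main.v *)
(** Normalise the slopes of V and W to 0.  For a fixed vertex a' of Q', the
    spaces U_(a,a') of a subrepresentation U of V (x) W form a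
    subrepresentation of V (x) W_a', a sum of copies of V, so their
    theta-degree is at most 0; symmetrically for a fixed vertex a of Q.  The
    degree of U for the sum weight is the sum of all these degrees. *)

From HB Require Import structures.
Require Import Defs.
From mathcomp Require Import all_boot all_order all_algebra.
From mathcomp Require Import boolp reals.

Set Implicit Arguments.
Unset Strict Implicit.
Unset Printing Implicit Defensive.

Import Order.TTheory GRing.Theory Num.Theory.
Local Open Scope ring_scope.

(** * Contraction of tensors by linear forms *)

Section Contraction.
Variable k : fieldType.
Implicit Types V W : vectType k.

Lemma dual_separates V (v : V) : (forall phi : dual V, phi v = 0) -> v = 0.
Proof.
move=> v0; rewrite (coord_vbasis (memvf v)) big1 // => i _.
have := v0 (linfun (coord (vbasis {:V}) i : V -> k^o)).
by rewrite lfunE /= => ->; rewrite scale0r.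
Qed.

(** The map [phi] ⊗ 1 from V ⊗ W to W; in the model Hom(V^*, W) it is evaluation at [phi]. *)
Definition contractl V W (phi : dual V) (t : tensor V W) : W := t phi.

Fact contractl_is_linear V W phi : linear (@contractl V W phi).
Proof. by move=> a x y; rewrite /contractl add_lfunE scale_lfunE. Qed.
HB.instance Definition _ V W phi :=
  GRing.isLinear.Build k (tensor V W) W _ (@contractl V W phi)
    (@contractl_is_linear V W phi).

(* The double dual of V has to be identified with V, hence the basis. *)
Definition contractr V W (psi : dual W) (t : tensor V W) : V :=
  \sum_(i < \dim {:V})
    (psi (t (linfun (coord (vbasis {:V}) i : V -> k^o))) : k)
      *: (vbasis {:V})`_i.

Fact contractr_is_linear V W psi : linear (@contractr V W psi).
Proof.
move=> a x y; rewrite /contractr scaler_sumr -big_split.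
apply: eq_bigr => i _ /=.
by rewrite add_lfunE scale_lfunE linearP scalerDl scalerA.
Qed.
HB.instance Definition _ V W psi :=
  GRing.isLinear.Build k (tensor V W) V _ (@contractr V W psi)
    (@contractr_is_linear V W psi).

(** Since forms separate vectors, this identity determines [contractr psi t] without reference to
    the basis. It follows by expanding [phi] in the dual basis. *)
Lemma contractrE V W (phi : dual V) (psi : dual W) (t : tensor V W) :
  phi (contractr psi t) = psi (t phi).
Proof.
have phiE : phi = \sum_(i < \dim {:V}) (phi (vbasis {:V})`_i : k) *:
    (linfun (coord (vbasis {:V}) i : V -> k^o) : dual V).
  apply/lfunP => v; rewrite sum_lfunE {1}(coord_vbasis (memvf v)) linear_sum.
  apply: eq_bigr => i _; rewrite scale_lfunE linearZ lfunE /=.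
  exact: mulrC.
rewrite [in RHS]phiE !linear_sum; apply: eq_bigr => i _.
by rewrite !linearZ; apply: mulrC.
Qed.

(** This commutation and the next one make contractions morphisms of representations from a slice of
    the tensor product to one factor. *)
Lemma contractl_tens_hom V W W' (phi : dual V) (g : 'Hom(W, W')) t :
  contractl phi (tens_hom \1 g t) = g (contractl phi t).
Proof.
by rewrite /contractl lfunE /= /tens_hom_fun !comp_lfunE dual_homE comp_lfun1r.
Qed.

Lemma contractr_tens_hom V V' W (psi : dual W) (f : 'Hom(V, V')) t :
  contractr psi (tens_hom f \1 t) = f (contractr psi t).
Proof.
(* Testing against all forms [phi] on [V'] replaces [contractr] by evaluation of the tensor, through
   [contractrE]. *)
apply/eqP; rewrite -subr_eq0; apply/eqP/dual_separates => phi.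
rewrite linearB /= contractrE lfunE /= /tens_hom_fun !comp_lfunE id_lfunE.
by rewrite dual_homE -contractrE comp_lfunE subrr.
Qed.

(** Joint injectivity: the contractions embed V ⊗ W in a power of W. *)
Lemma contractl_eq0 V W (t : tensor V W) :
  (forall phi, contractl phi t = 0) -> t = 0.
Proof. by move=> t0; apply/lfunP => phi; rewrite lfunE; exact: t0. Qed.

Lemma contractr_eq0 V W (t : tensor V W) :
  (forall psi, contractr psi t = 0) -> t = 0.
Proof.
move=> t0; apply/lfunP => phi; rewrite lfunE; apply/dual_separates => psi.
by rewrite -contractrE t0 linear0.
Qed.

End Contraction.

(** * Slope bounds as signs of an additive function *)

Section Excess.
Variables (R : realType) (k : fieldType) (Q : quiver) (theta : weight R Q).
Implicit Types V T : representation k Q.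

(** The degree for the weight shifted so that slope [mu] becomes 0. Unlike the slope, it is additive
    in the dimension vector [d] and makes sense for [d] = 0. *)
Definition excess (mu : R) (d : vertex Q -> nat) : R :=
  \sum_(a : vertex Q) (theta a - mu) * (d a)%:R.

Lemma excessE mu d :
  excess mu d =
    \sum_(a : vertex Q) theta a * (d a)%:R - mu * (\sum_(a : vertex Q) d a)%:R.
Proof.
rewrite natr_sum mulr_sumr -sumrB; apply: eq_bigr => a _; exact: mulrBl.
Qed.

Lemma rep_rk_gt0 V : nonzero_rep V -> (0 < rep_rk V)%N.
Proof.
case=> a Va; rewrite /rep_rk (bigD1 a) //= addn_gt0.
by rewrite lt0n dimv_eq0 Va.
Qed.

Lemma rep_slope_le V mu : nonzero_rep V ->
  (rep_slope theta V <= mu) =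
    (excess mu (fun a => \dim {: rep_space V a}) <= 0).
Proof.
move=> /rep_rk_gt0 V0.
by rewrite excessE subr_le0 /rep_slope ler_pdivrMr // ltr0n.
Qed.

(** The bound also covers the two extreme cases: the zero subrepresentation has excess 0, and for
    [V] itself the slope inequality is an equality. *)
Lemma semistable_excess V (U : subrep V) : semistable theta V ->
  excess (rep_slope theta V) (fun a => \dim (subrep_space U a)) <= 0.
Proof.
move=> [V0 Vss].
have UE : excess (rep_slope theta V) (fun a => \dim (subrep_space U a)) =
    excess (rep_slope theta V)
      (fun a => \dim {: rep_space (rep_of_subrep U) a}).
  by apply: eq_bigr => a _; rewrite [in RHS]dimvf.
have [Upr|Unpr] := pselect (proper_subrep U).
  have [U0|Un0] := pselect (nonzero_rep (rep_of_subrep U)).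
    by rewrite UE -rep_slope_le //; exact: Vss.
  rewrite UE /excess big1 // => a _.
  have [->|Ua] := eqVneq {: rep_space (rep_of_subrep U) a}%VS 0%VS.
    by rewrite dimv0 mulr0.
  by case: Un0; exists a.
have UV a : subrep_space U a = {: rep_space V a}%VS.
  by apply/eqP; apply: contra_notT Unpr => Ua; exists a.
rewrite (_ : excess _ _ =
    excess (rep_slope theta V) (fun a => \dim {: rep_space V a})).
  by rewrite -rep_slope_le.
by apply: eq_bigr => a _; rewrite UV.
Qed.

(** * Representations embedded in a power of a semistable one *)

Section Cogenerated.
Variables (V T : representation k Q) (I : Type).
Variable f : I -> forall a, 'Hom(rep_space T a, rep_space V a).
Hypothesis f_morph : forall i alpha x,
  f i (target alpha) (rep_map T alpha x) = rep_map V alpha (f i (source alpha) x).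
Hypothesis f_inj : forall a x, (forall i, f i a x = 0) -> x = 0.

Lemma image_stable (N : subrep T) i alpha :
  (rep_map V alpha @: (f i (source alpha) @: subrep_space N (source alpha))
     <= f i (target alpha) @: subrep_space N (target alpha))%VS.
Proof.
apply/subvP => _ /memv_imgP[_ /memv_imgP[x xN ->] ->].
rewrite -f_morph memv_img //.
by apply: (subvP (subrep_stable N alpha)); rewrite memv_img.
Qed.

Lemma kernel_stable (N : subrep T) i alpha :
  (rep_map T alpha @:
       (subrep_space N (source alpha) :&: lker (f i (source alpha)))
     <= subrep_space N (target alpha) :&: lker (f i (target alpha)))%VS.
Proof.
apply/subvP => _ /memv_imgP[x /[!memv_cap]/andP[xN xf] ->].
rewrite memv_ker f_morph; move: xf; rewrite memv_ker => /eqP ->.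
rewrite linear0 eqxx andbT.
by apply: (subvP (subrep_stable N alpha)); rewrite memv_img.
Qed.

(* T embeds in a power of V; induction on the total dimension of N, splitting
   N into its kernel and its image under one of the [f i]. *)
Lemma cogenerated_excess (N : subrep T) : semistable theta V ->
  excess (rep_slope theta V) (fun a => \dim (subrep_space N a)) <= 0.
Proof.
move=> Vss; have [n] := ubnP (\sum_(a : vertex Q) \dim (subrep_space N a)).
elim: n N => // n IHn N; rewrite ltnS => Nn.
have [N0|] := pselect (forall a, subrep_space N a = 0%VS).
  by rewrite /excess big1 // => a _; rewrite N0 dimv0 mulr0.
move=> /existsNP[a /eqP Na].
(* [vpick] of a nonzero space is a nonzero vector, so by joint injectivity some [f i] does not kill
   it. *)
have [i fi] : exists i, f i a (vpick (subrep_space N a)) <> 0.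
  apply: contrapT => /forallNP fa; move: Na; rewrite -vpick0.
  by rewrite (f_inj (fun i => contrapT (fa i))) eqxx.
pose K := @Subrep k Q T (fun b => subrep_space N b :&: lker (f i b))%VS
  (kernel_stable N i).
pose J := @Subrep k Q V (fun b => f i b @: subrep_space N b)%VS
  (image_stable N i).
have dimN b : \dim (subrep_space N b) =
    (\dim (subrep_space K b) + \dim (subrep_space J b))%N.
  by rewrite limg_ker_dim.
have -> : excess (rep_slope theta V) (fun a => \dim (subrep_space N a)) =
    excess (rep_slope theta V) (fun a => \dim (subrep_space K a)) +
    excess (rep_slope theta V) (fun a => \dim (subrep_space J a)).
  rewrite /excess -big_split; apply: eq_bigr => b _.
  by rewrite dimN natrD mulrDr.
rewrite -[leRHS]addr0 lerD ?semistable_excess ?IHn //.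
(* The induction hypothesis applies to [K] because its total dimension is smaller than that of [N]:
   [J] is nonzero at [a], as it contains the image of the picked vector. *)
apply: leq_trans Nn; under [leqRHS]eq_bigr do rewrite dimN.
rewrite big_split /= -[ltnLHS]addn0 ltn_add2l (bigD1 a) //= addn_gt0.
rewrite lt0n dimv_eq0; apply/orP; left; apply/eqP => Ja.
have := memv_img (f i a) (memv_pick (subrep_space N a)).
by rewrite Ja memv0 => /eqP.
Qed.

End Cogenerated.
End Excess.

(** * Slices of a subrepresentation and additivity of the slope *)

Section TensorSemistable.
Variables (R : realType) (k : fieldType) (Q Q' : quiver).
Variables (theta : weight R Q) (theta' : weight R Q').
Variables (V : representation k Q) (W : representation k Q').
Implicit Type U : subrep (tensor_rep V W).

Lemma excess_slicel U a' : semistable theta V ->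
  excess theta (rep_slope theta V) (fun a => \dim (subrep_space U (a, a'))) <= 0.
Proof.
(* The arrows [inr (alpha, a')] act on the slice at [a'] through the maps of [V], and the
   contractions by forms on the space of [W] at [a'] embed it in a power of [V]. *)
pose T := @Representation k Q (fun a => tensor (rep_space V a) (rep_space W a'))
  (fun alpha => tens_hom (rep_map V alpha) \1).
pose N := @Subrep k Q T (fun a => subrep_space U (a, a'))
  (fun alpha => @subrep_stable _ _ _ U (inr (alpha, a'))).
apply: (@cogenerated_excess _ _ _ _ V T (dual (rep_space W a'))
  (fun psi a => linfun (contractr psi)) _ _ N) => [psi alpha t|a t t0].
  by rewrite [LHS]lfunE [in RHS]lfunE; exact: contractr_tens_hom.
by apply: contractr_eq0 => psi; rewrite -(t0 psi) lfunE.
Qed.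

Lemma excess_slicer U a : semistable theta' W ->
  excess theta' (rep_slope theta' W) (fun a' => \dim (subrep_space U (a, a')))
    <= 0.
Proof.
pose T := @Representation k Q'
  (fun a' => tensor (rep_space V a) (rep_space W a'))
  (fun alpha => tens_hom \1 (rep_map W alpha)).
pose N := @Subrep k Q' T (fun a' => subrep_space U (a, a'))
  (fun alpha => @subrep_stable _ _ _ U (inl (a, alpha))).
apply: (@cogenerated_excess _ _ _ _ W T (dual (rep_space V a))
  (fun phi a' => linfun (contractl phi)) _ _ N) => [phi alpha t|a' t t0].
  by rewrite [LHS]lfunE [in RHS]lfunE; exact: contractl_tens_hom.
by apply: contractl_eq0 => phi; rewrite -(t0 phi) lfunE.
Qed.

(** The shifted sum weight at (a, a') is (theta a - mu) + (theta' a' - mu'); the two terms are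
    summed over the pairs in opposite orders. *)
Lemma excess_sum_weight mu mu' (d : vertex (internal_product Q Q') -> nat) :
  excess (sum_weight theta theta') (mu + mu') d =
    \sum_(a' : vertex Q') excess theta mu (fun a => d (a, a')) +
    \sum_(a : vertex Q) excess theta' mu' (fun a' => d (a, a')).
Proof.
rewrite /excess exchange_big -big_split /=.
under [RHS]eq_bigr do rewrite -big_split.
rewrite pair_bigA; apply: eq_bigr => -[a a'] _ /=.
by rewrite ffunE -mulrDl addrACA opprD.
Qed.

Lemma rep_rk_tensor : rep_rk (tensor_rep V W) = (rep_rk V * rep_rk W)%N.
Proof.
rewrite /rep_rk big_distrlr /= pair_bigA.
by apply: eq_bigr => p _; rewrite dim_tensor.
Qed.

Lemma rep_deg_tensor :
  rep_deg (sum_weight theta theta') (tensor_rep V W) =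
    rep_deg theta V * (rep_rk W)%:R + (rep_rk V)%:R * rep_deg theta' W.
Proof.
rewrite /rep_deg /rep_rk !natr_sum !big_distrlr /= !pair_bigA -big_split.
apply: eq_bigr => p _ /=.
by rewrite ffunE dim_tensor natrM mulrDl mulrA mulrCA.
Qed.

Lemma nonzero_tensor :
  nonzero_rep V -> nonzero_rep W -> nonzero_rep (tensor_rep V W).
Proof.
move=> [a Va] [a' Wa']; exists (a, a').
by rewrite -dimv_eq0 dim_tensor muln_eq0 !dimv_eq0 negb_or Va.
Qed.

(** Ranks multiply while degrees obey a Leibniz rule, so the quotient is a sum of two fractions with
    nonzero denominators. *)
Lemma rep_slope_tensor : nonzero_rep V -> nonzero_rep W ->
  rep_slope (sum_weight theta theta') (tensor_rep V W) =
    rep_slope theta V + rep_slope theta' W.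
Proof.
move=> /rep_rk_gt0 V0 /rep_rk_gt0 W0.
rewrite /rep_slope rep_deg_tensor rep_rk_tensor natrM addf_div.
- by rewrite [_ * rep_deg theta' W]mulrC.
- by rewrite pnatr_eq0 -lt0n.
- by rewrite pnatr_eq0 -lt0n.
Qed.

End TensorSemistable.

Theorem proposition2p5 (R : realType) (k : fieldType) (Q Q' : quiver)
    (theta : weight R Q) (theta' : weight R Q')
    (theta_rat : rational_weight theta) (theta'_rat : rational_weight theta')
    (V : representation k Q) (W : representation k Q')
    (V_ss : semistable theta V) (W_ss : semistable theta' W) :
  semistable (sum_weight theta theta') (tensor_rep V W).
Proof.
have [[V0 _] [W0 _]] := (V_ss, W_ss).
split=> [|U U0 _]; first exact: nonzero_tensor.
(* Slopes add, so the excess of [U] at the slope of the tensor product splits into excesses of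
   slices at the slopes of [V] and [W], each at most 0. *)
rewrite rep_slope_le // rep_slope_tensor // excess_sum_weight.
rewrite -[leRHS]addr0 lerD // sumr_le0 // => a _.
(* [dimvf] turns the dimension of the full space of [subvs_of] into that of the subspace, up to
   conversion. *)
- under [leLHS]eq_bigr do rewrite dimvf; exact: excess_slicel.
- under [leLHS]eq_bigr do rewrite dimvf; exact: excess_slicer.
Qed.
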